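(* Let $p>1$, $\frac1p+\frac1{p'}=1$, let $s_*\in(0,1)$, and let $g,d,h:[0,1]\to\mathbb{R}$ satisfy the standing assumptions on $g$, $d$, $h$ listed in the context. Suppose further that $$\int_{s_*}^t(h(s_* )-h(\tau))\,d\tau>0\quad\text{for all } t\in[0,1]\setminus\{s_*\},$$ that $$(d(t))^{\frac1{p-1}}g(t)<\frac1{p'p^{p'/p}}(h(s_* )-h(t))\Big[\int_{s_*}^t(h(s_* )-h(\tau))\,d\tau\Big]^{\frac{p'}p},\quad t\in(s_*,1),$$ and that $$(d(t))^{\frac1{p-1}}g(t)>\frac1{p'p^{p'/p}}(h(s_* )-h(t))\Big[\int_{s_*}^t(h(s_* )-h(\tau))\,d\tau\Big]^{\frac{p'}p},\quad t\in(0,s_* ).$$ Then the problem $$(d(U)|U'|^{p-2}U')'+(c-h(U))U'+g(U)=0 \ \text{ on } \mathbb{R},\qquad \lim_{z\to-\infty}U(z)=1,\quad \lim_{z\to+\infty}U(z)=0 \tag{P}$$ has no monotone decreasing solution for any $c\in\mathbb{R}$.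
   Context: Standing assumptions on $g,d,h$: - $g:[0,1]\to\mathbb{R}$ is continuous, $g(0)=g(s_* )=g(1)=0$, $g<0$ in $(0,s_* )$, $g>0$ in $(s_*,1)$. - $d:[0,1]\to\mathbb{R}$ is nonnegative, lower semicontinuous on $[0,1]$ and strictly positive in $(0,1)$. There are points $0=m_0<m_1<\dots<m_r<m_{r+1}=1$ such that $d$ has jump discontinuities at $m_i$ ($i=1,\dots,r$) and $d|_{(m_i,m_{i+1})}\in C(m_i,m_{i+1})$, $i=0,\dots,r$. In addition $d^{\frac1{p-1}}g\in L^1(0,1)$ and $\int_0^1(d(t))^{\frac1{p-1}}g(t)\,dt\ge0$. - $h:[0,1]\to\mathbb{R}$ is bounded and continuous at $s_*$. There are points $0=k_0<k_1<\dots<k_q<k_{q+1}=1$ such that $h$ has jump discontinuities at $k_j$ ($j=1,\dots,q$) and $h|_{(k_j,k_{j+1})}\in C(k_j,k_{j+1})$, $j=0,\dots,q$. Notation. For a monotone continuous $U:\mathbb{R}\to[0,1]$ set $M_U=\{z:U(z)=m_i \text{ for some } i=1,\dots,r\}$, $N_U=\{z:U(z)=0\text{ or }U(z)=1\}$, $D_U=\partial M_U\cup\partial N_U$, and $H(u)=\int_0^u h(s)\,ds$. Monotone solution. A monotone continuous function $U:\mathbb{R}\to[0,1]$ is a monotone solution of $(d(U)|U'|^{p-2}U')'+(c-h(U))U'+g(U)=0$ if: (a) $U\in C^1(\mathbb{R}\setminus D_U)$ and $U'(z)\ne0$ for all $z\in\mathbb{R}\setminus D_U$ with $U(z)\in(0,1)$;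 (b) for any $z\in\partial M_U$ there exist finite nonzero one-sided derivatives $U'(z-),U'(z+)$ and $L(z):=|U'(z-)|^{p-2}U'(z-)\lim_{\xi\to z-}d(U(\xi))=|U'(z+)|^{p-2}U'(z+)\lim_{\xi\to z+}d(U(\xi))$; (c) the function $v:\mathbb{R}\to\mathbb{R}$ given by $v(z)=d(U(z))|U'(z)|^{p-2}U'(z)$ for $z\notin\partial M_U\cup\partial N_U$, $v(z)=0$ for $z\in\partial N_U$, $v(z)=L(z)$ for $z\in\partial M_U$, is continuous, satisfies, for all $z,\hat z\in\mathbb{R}$, $v(\hat z)-v(z)+c(U(\hat z)-U(z))-(H(U(\hat z))-H(U(z)))+\int_z^{\hat z}g(U(\tau))\,d\tau=0$, and $\lim_{z\to\pm\infty}v(z)=0$. A monotone decreasing solution of (P) is a nonincreasing monotone solution, in this sense, that satisfies the boundary conditions in (P) (so $U'<0$, or both one-sided derivatives are negative, at every point where $U(z)\in(0,1)$). *)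

(* Defs.v *)
From HB Require Import structures.
From mathcomp Require Import all_boot all_order all_algebra.
From mathcomp Require Import all_classical all_reals all_analysis.
Import Order.TTheory GRing.Theory Num.Theory.
Import numFieldNormedType.Exports.

Set Implicit Arguments.
Unset Strict Implicit.
Unset Printing Implicit Defensive.

Local Open Scope classical_set_scope.
Local Open Scope ring_scope.

(* Functions on [0, 1] are represented by total functions R -> R; only their
   values on [0, 1] matter below. *)

(* Signed integral: the limits of integration may come in either order. *)
Definition oint {R : realType} (f : R -> R) (a b : R) : R :=
  if a <= b then \int[@lebesgue_measure R]_(x in `[a, b]) f x
  else - \int[@lebesgue_measure R]_(x in `[b, a]) f x.

Definition boundary {T : topologicalType} (A : set T) : set T :=
  closure A `\` interior A.

(* 0 = m 0 < m 1 < ... < m r < m r.+1 = 1, with jump discontinuities of f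
   exactly at m 1, ..., m r; values of m beyond r.+1 are irrelevant.  The
   library's [discontinuity] is the jump discontinuity: both one-sided limits
   exist in R and they differ. *)
Record jump_partition {R : realType} (f : R -> R) (r : nat) (m : nat -> R) :
  Prop := {
  jump_first : m 0%N = 0;
  jump_last : m r.+1 = 1;
  jump_lt : forall i, (i <= r)%N -> m i < m i.+1;
  jump_at : forall i, (1 <= i <= r)%N -> discontinuity f (m i);
  jump_continuous : forall i, (i <= r)%N ->
    {in `]m i, m i.+1[, continuous f} }.

Record g_assumptions {R : realType} (s : R) (g : R -> R) : Prop := {
  g_continuous : {within `[0, 1], continuous g};
  g_at0 : g 0 = 0;
  g_ats : g s = 0;
  g_at1 : g 1 = 0;
  g_lt0 : forall t, 0 < t < s -> g t < 0;
  g_gt0 : forall t, s < t < 1 -> 0 < g t }.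

(* Lower semicontinuity on [0, 1] is that of the restriction, i.e. with
   respect to the subspace topology. *)
Record d_assumptions {R : realType} (p : R) (g d : R -> R) (r : nat)
  (m : nat -> R) : Prop := {
  d_ge0 : forall t, 0 <= t <= 1 -> 0 <= d t;
  d_lsc : @lower_semicontinuous (subspace `[0 : R, 1]) R (fun t => (d t)%:E);
  d_gt0 : forall t, 0 < t < 1 -> 0 < d t;
  d_jumps : jump_partition d r m;
  d_integrable : (@lebesgue_measure R).-integrable `]0, 1[
    (fun t => (d t `^ (p - 1)^-1 * g t)%:E);
  d_int_ge0 : 0 <= \int[@lebesgue_measure R]_(t in `]0, 1[)
    (d t `^ (p - 1)^-1 * g t) }.

Record h_assumptions {R : realType} (s : R) (h : R -> R) (q : nat)
  (k : nat -> R) : Prop := {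
  h_bounded : [bounded h x | x in `[0 : R, 1]];
  h_continuous_at : {for s, continuous h};
  h_jumps : jump_partition h q k }.

(* One-sided derivatives: limits of the difference quotient. *)
Definition diff_quot {R : realType} (U : R -> R) (z : R) : R -> R :=
  fun e => e^-1 * (U (e + z) - U z).
Definition derivl {R : realType} (U : R -> R) (z : R) : R :=
  lim (diff_quot U z e @[e --> 0^'-]).
Definition derivr {R : realType} (U : R -> R) (z : R) : R :=
  lim (diff_quot U z e @[e --> 0^'+]).

(* |x|^(p-2) x; its value at x = 0 is 0, also when 1 < p < 2. *)
Definition plap {R : realType} (p x : R) : R := `|x| `^ (p - 2) * x.

Definition M_set {R : realType} (r : nat) (m : nat -> R) (U : R -> R) : set R :=
  [set z | exists2 i, (1 <= i <= r)%N & U z = m i].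
Definition N_set {R : realType} (U : R -> R) : set R :=
  [set z | U z = 0 \/ U z = 1].
Definition D_set {R : realType} (r : nat) (m : nat -> R) (U : R -> R) : set R :=
  boundary (M_set r m U) `|` boundary (N_set U).

Definition fluxl {R : realType} (p : R) (d U : R -> R) (z : R) : R :=
  plap p (derivl U z) * lim (d (U x) @[x --> z^'-]).
Definition fluxr {R : realType} (p : R) (d U : R -> R) (z : R) : R :=
  plap p (derivr U z) * lim (d (U x) @[x --> z^'+]).

(* For continuous U the boundaries of M_set and N_set are disjoint, so the
   order of the tests is immaterial; on the boundary of M_set, fluxl and fluxr
   agree for a monotone solution. *)
Definition flux {R : realType} (p : R) (d : R -> R) (r : nat) (m : nat -> R)
  (U : R -> R) (z : R) : R :=
  if z \in boundary (M_set r m U) then fluxl p d U z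
  else if z \in boundary (N_set U) then 0
  else d (U z) * plap p (derive1 U z).

Record monotone_solution {R : realType} (p : R) (g d h : R -> R) (r : nat)
  (m : nat -> R) (c : R) (U : R -> R) : Prop := {
  sol_monotone : nonincreasing_fun U \/ nondecreasing_fun U;
  sol_continuous : continuous U;
  sol_range : forall z, 0 <= U z <= 1;
  sol_C1 : forall z, ~ D_set r m U z ->
    derivable U z 1 /\ {for z, continuous (derive1 U)};
  sol_deriv_neq0 : forall z, ~ D_set r m U z -> 0 < U z < 1 -> derive1 U z != 0;
  sol_derivl : forall z, boundary (M_set r m U) z ->
    cvg (diff_quot U z e @[e --> 0^'-]) /\ derivl U z != 0;
  sol_derivr : forall z, boundary (M_set r m U) z ->
    cvg (diff_quot U z e @[e --> 0^'+]) /\ derivr U z != 0;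
  sol_dlim : forall z, boundary (M_set r m U) z ->
    cvg (d (U x) @[x --> z^'-]) /\ cvg (d (U x) @[x --> z^'+]);
  sol_transition : forall z, boundary (M_set r m U) z ->
    fluxl p d U z = fluxr p d U z;
  sol_flux_continuous : continuous (flux p d r m U);
  sol_equation : forall z z',
    flux p d r m U z' - flux p d r m U z + c * (U z' - U z)
      - (oint h 0 (U z') - oint h 0 (U z)) + oint (fun x => g (U x)) z z' = 0;
  sol_flux_pinfty : flux p d r m U z @[z --> +oo] --> (0 : R);
  sol_flux_ninfty : flux p d r m U z @[z --> -oo] --> (0 : R) }.

Record decreasing_solution {R : realType} (p : R) (g d h : R -> R) (r : nat)
  (m : nat -> R) (c : R) (U : R -> R) : Prop := {
  dec_solution : monotone_solution p g d h r m c U;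
  dec_nonincreasing : nonincreasing_fun U;
  dec_ninfty : U z @[z --> -oo] --> (1 : R);
  dec_pinfty : U z @[z --> +oo] --> (0 : R) }.

(* Main.v *)
Require Import Defs.
From HB Require Import structures.
From mathcomp Require Import all_boot all_order all_algebra.
From mathcomp Require Import all_classical all_reals all_analysis.
From mathcomp Require Import measurable_realfun ring lra.
Import Order.TTheory GRing.Theory Num.Theory.
Import numFieldNormedType.Exports.
Local Open Scope classical_set_scope.
Local Open Scope ring_scope.

Set Implicit Arguments.
Unset Strict Implicit.
Unset Printing Implicit Defensive.

(** Suppose that [U] is a decreasing solution with flux [v], and let
    [Phi t] be the integral of [h s - h] from [s] to [t], which vanishes at [s]
    and is positive elsewhere on [0, 1].  The idea is to compare the positive
    quantity [- v], seen as a function of the level [t = U z], with the barrier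
    [Phi / p].

    Formally, in the variable [t], [w := - v] solves
      [w' = c - h - d `^ (1/(p-1)) * g / w `^ (1/(p-1))].
    Take [h s <= c] and [s < t < 1].  Where [w >= Phi / p], the hypothesis on
    [d `^ (1/(p-1)) * g] bounds the last term by [(h s - h) / p'], so that
    [w' > (c - h s) + (h s - h) * (1 - 1/p') >= Phi' / p]: above the barrier,
    [w - Phi / p] increases with [t].  But [w - Phi / p] is positive at [t = s],
    where [Phi] vanishes, and tends to [- Phi 1 / p < 0] as [t] tends to 1, so
    it would have to reach 0 from above as [t] increases.  If [c <= h s],
    the same comparison on [(0, s)], with all signs reversed, is contradictory.
    The constants fit because of [1/p + 1/p' = 1] ([slope_bound]).

    The proof works in the variable [z] with
    [F z := - v z - Phi (U z) / p].  The coefficients jump at finitely many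
    levels, and at such a level the strict inequality could degenerate to an
    equality in the limit.  This is harmless: strict monotonicity of [U]
    ([profile_decreasing]) gives each zero of [F] a one-sided
    neighbourhood free of jump levels, where the equation can be differentiated
    ([is_derive_comparison]) and the sign of [F'] is known at the points where
    [F] is positive ([comparison_slope_right], [comparison_slope_left]).  The
    mean value theorem then excludes the crossing
    ([no_upcrossing_of_slope_lt0], [no_downcrossing_of_slope_gt0]). *)

(** * The slope inequality *)

Lemma plap_lt0 (R : realType) (p x : R) : x < 0 -> plap p x < 0.
Proof.
by move=> x0; rewrite /plap pmulr_rlt0// powR_gt0// normr_gt0 lt_eqF.
Qed.

(** The algebraic heart of the argument.  Read [D] as the diffusion, [y] as
    [-U'], [P] as the value of the barrier integral, so that [D * y `^ (p - 1)]
    is minus the flux.  Raising [P / p < D * y `^ (p - 1)] to the power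
    [1 / (p - 1)] and multiplying by [a * (1 - 1/p)] reproduces the constant of
    the hypothesis exactly: the slope [1 / p] of the barrier is the one for
    which [1/p + 1/p' = 1] closes the estimate. *)
Lemma slope_bound (R : realType) (p a G D P y : R) :
  1 < p -> 0 < D -> 0 < P -> 0 < y -> 0 < G ->
  P / p < D * y `^ (p - 1) ->
  D `^ (p - 1)^-1 * G <
    (p / (p - 1) * p `^ (p - 1)^-1)^-1 * a * P `^ (p - 1)^-1 ->
  G < y * (a * (1 - p^-1)).
Proof.
move=> p1 D0 P0 y0 G0 Pw DG; set e := (p - 1)^-1 in DG.
have p0 : 0 < p by lra.
have e0 : 0 < e by rewrite invr_gt0 subr_gt0.
have De0 : 0 < D `^ e by exact: powR_gt0.
have Pe0 : 0 < P `^ e by exact: powR_gt0.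
have pe0 : 0 < p `^ e by exact: powR_gt0.
have Py : (P / p) `^ e < D `^ e * y.
  have -> : D `^ e * y = (D * y `^ (p - 1)) `^ e.
    rewrite powRM ?powR_ge0// ?ltW// -powRrM mulfV ?powRr1 ?ltW//.
    by rewrite subr_eq0 gt_eqF.
  apply: gt0_ltr_powR => //; rewrite nnegrE ?divr_ge0 ?mulr_ge0 ?powR_ge0 ?ltW//.
have Pp : (P / p) `^ e = P `^ e / p `^ e.
  by rewrite powRM ?invr_ge0 ?ltW// -powR_inv1 ?ltW// powRAC powR_inv1// ltW.
rewrite Pp in Py.
(* [1 - 1/p] is the inverse of the conjugate exponent [p / (p - 1)]. *)
have eqK : (p / (p - 1) * p `^ e)^-1 * a * P `^ e = a * (1 - p^-1) * (P `^ e / p `^ e).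
  by field; rewrite !gt_eqF ?subr_gt0.
rewrite {}eqK in DG.
have q0 : 0 < P `^ e / p `^ e by exact: divr_gt0.
have a0 : 0 < a * (1 - p^-1).
  by have := lt_trans (mulr_gt0 De0 G0) DG; rewrite pmulr_lgt0.
rewrite -(ltr_pM2l De0); apply: (lt_trans DG).
have -> : D `^ e * (y * (a * (1 - p^-1))) = a * (1 - p^-1) * (D `^ e * y) by ring.
by rewrite ltr_pM2l.
Qed.

(** * One-sided crossings *)

Lemma last_upcrossing (R : realType) (F : R -> R) (a b : R) :
  continuous F -> a < b -> F a < 0 -> 0 < F b ->
  exists x, [/\ a < x < b, F x = 0 & forall y, x < y <= b -> 0 < F y].
Proof.
move=> cF ab Fa Fb; pose E := [set x | x <= b /\ F x <= 0].
have Ea : E a by split; exact: ltW.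
have ubE : has_ubound E by exists b => x [].
have supE : has_sup E by split => //; exists a.
pose x := sup E.
have ax : a <= x by exact: ub_le_sup.
have xb : x <= b by apply: ge_sup; [exists a | move=> y []].
have Epos y : x < y <= b -> 0 < F y.
  move=> /andP[xy yb]; rewrite ltNge; apply/negP => Fy.
  by have := ub_le_sup ubE (conj yb Fy : E y); rewrite leNgt xy.
have Fx0 : F x <= 0.
  rewrite leNgt; apply/negP => Fx.
  have /nbhs_ballP[e /= e0 He] : \forall y \near x, 0 < F y.
    exact: (@cvgr_gt _ _ _ _ F _ (cF x) 0 Fx).
  have [y [yb Fy] xy] := sup_adherent e0 supE.
  have yx : y <= x by exact: ub_le_sup.
  have : 0 < F y by apply: He; rewrite /ball/= ger0_norm ?subr_ge0// ltrBlDl -ltrBlDr.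
  by rewrite ltNge Fy.
have xb' : x < b by rewrite lt_neqAle xb andbT; apply: contraTneq Fb => <-; rewrite -leNgt.
have Fx : F x = 0.
  apply/eqP; rewrite eq_le Fx0 leNgt; apply/negP => Fx.
  have /nbhs_ballP[e /= e0 He] : \forall y \near x, F y < 0.
    exact: (@cvgr_lt _ _ _ _ F _ (cF x) 0 Fx).
  pose y := Num.min (x + e / 2) b.
  have xy : x < y by rewrite lt_min xb' ltrDl divr_gt0.
  have ye : y <= x + e / 2 by rewrite ge_min lexx.
  have yb : y <= b by rewrite ge_min lexx orbT.
  have : F y < 0.
    by apply: He; rewrite /ball/= distrC ger0_norm ?subr_ge0 ?ltW//; lra.
  by rewrite ltNge ltW// Epos// xy.
exists x; split => //; rewrite xb' andbT lt_neqAle ax andbT.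
by apply: contraTneq Fa => ->; rewrite Fx ltxx.
Qed.

(** A function that goes from negative to positive values has a last zero,
    after which it is positive; it cannot be strictly decreasing right after
    that zero.  The slope is only asked for where [F] is positive: this is
    what makes the estimate of [slope_bound] available. *)
Lemma no_upcrossing_of_slope_lt0 (R : realType) (F : R -> R) (a b : R) :
  continuous F -> a < b -> F a < 0 -> 0 < F b ->
  (forall x, x < b -> F x = 0 -> \forall y \near x^'+,
     0 < F y -> exists2 l, is_derive y 1 F l & l < 0) -> False.
Proof.
move=> cF ab Fa Fb dF.
have [x [/andP[ax xb] Fx Fpos]] := last_upcrossing cF ab Fa Fb.
have [e /= e0 He] := dF x xb Fx.
pose y := Num.min (x + e / 2) b.
have xy : x < y by rewrite lt_min xb ltrDl divr_gt0.
have ye : y <= x + e / 2 by rewrite ge_min lexx.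
have yb : y <= b by rewrite ge_min lexx orbT.
have der t : x < t < y -> exists2 l, is_derive t 1 F l & l < 0.
  move=> /andP[xt ty]; apply: He => //.
    by rewrite /ball/= distrC ger0_norm ?subr_ge0 ?ltW//; lra.
  by apply: Fpos; rewrite xt (le_trans (ltW ty)).
have [t| |t] := @MVT _ F (derive1 F) x y xy.
- rewrite in_itv/= => /der[l [Fl dl] _].
  by rewrite derive1E; apply: DeriveDef.
- exact: continuous_subspaceT.
rewrite in_itv/= => /[dup] xty /der[l [Fl dl] l0].
have Fy : 0 < F y by rewrite Fpos// xy.
rewrite derive1E dl Fx subr0 => Fyl; move: Fy.
by rewrite Fyl ltNge mulr_le0_ge0// ?subr_ge0 ltW.
Qed.

Lemma no_downcrossing_of_slope_gt0 (R : realType) (F : R -> R) (a b : R) :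
  continuous F -> a < b -> 0 < F a -> F b < 0 ->
  (forall x, a < x -> F x = 0 -> \forall y \near x^'-,
     0 < F y -> exists2 l, is_derive y 1 F l & 0 < l) -> False.
Proof.
move=> cF ab Fa Fb dF.
apply: (@no_upcrossing_of_slope_lt0 _ (F \o -%R) (- b) (- a)) => /=;
  rewrite ?opprK ?ltrN2//.
  move=> x; apply: (@continuous_comp _ _ _ -%R F x); first exact: opp_continuous.
  exact: (cF (- x)).
move=> x xa Fx; have ax : a < - x by rewrite ltrNr.
have := dF _ ax Fx; rewrite at_leftN => near_x.
apply: (@filterS _ (x^'+) _ _ _ _ near_x) => y H /H [l dl l0].
exists (- l); rewrite ?oppr_lt0// -mulrN1.
exact: (@is_derive1_comp _ F -%R y l (-1) dl (is_deriveNid y 1)).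
Qed.

(** * Oriented integrals as primitives *)

Section OrientedIntegral.
Variables (R : realType) (f : R -> R) (A B : R).
Notation mu := (@lebesgue_measure R).
Hypothesis intf : mu.-integrable `[A, B] (EFin \o f).

Lemma oint_primitive (a x : R) : A <= a <= B -> A <= x <= B ->
  oint f a x = \int[mu]_(t in `[A, x]) f t - \int[mu]_(t in `[A, a]) f t.
Proof.
have sub (u v : R) : A <= u -> u <= v -> v <= B ->
    \int[mu]_(t in `[u, v]) f t =
    \int[mu]_(t in `[A, v]) f t - \int[mu]_(t in `[A, u]) f t.
  move=> Au uv vB.
  rewrite Rintegral_itvB ?bnd_simp//; last first.
    by apply: integrableS intf => //; apply: subset_itvl; rewrite bnd_simp.
  rewrite Rintegral_itv_obnd_cbnd//.
  by apply: integrableS intf => //; apply: subset_itv; rewrite bnd_simp.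
move=> /andP[Aa aB] /andP[Ax xB]; rewrite /oint.
by case: (leP a x) => [ax|/ltW xa]; rewrite sub// opprB.
Qed.

Lemma continuous_oint (a : R) : A <= a <= B ->
  {within `[A, B], continuous (oint f a)}.
Proof.
move=> aAB; have AB : A <= B by case/andP: aAB; exact: le_trans.
pose I x := \int[mu]_(t in `[A, x]) f t.
apply: (@subspace_eq_continuous _ _ _ (fun x => I x - I a)).
  by move=> x; rewrite inE /= in_itv /= => xAB; exact: esym (oint_primitive aAB xAB).
move=> x; apply: continuousB; last exact: cst_continuous.
exact: (parameterized_integral_continuous AB intf).
Qed.

Lemma is_derive_oint (a x : R) : A <= a <= B -> A < x < B ->
  {for x, continuous f} -> is_derive x 1 (oint f a) (f x).
Proof.
move=> aAB /andP[Ax xB] cf.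
have [dF F'] := continuous_FTC1_closed xB intf Ax cf.
have dF1 : is_derive x 1
    (fun y => \int[mu]_(t in `[A, y]) f t - \int[mu]_(t in `[A, a]) f t) (f x).
  apply: is_derive_eq (subr0 _).
  apply: is_deriveB.
  by apply: DeriveDef => //; rewrite -derive1E.
apply: near_eq_is_derive dF1 => //.
near=> y; rewrite oint_primitive//; apply/andP; split.
  by near: y; exact: lt_le_nbhsr.
by near: y; exact: lt_le_nbhsl.
Unshelve. all: by end_near. Qed.

End OrientedIntegral.

(** * Piecewise continuous functions *)

Lemma jump_partition_interval (R : realType) (f : R -> R) n (a : nat -> R) u :
  jump_partition f n a -> 0 < u < 1 ->
  (forall i, (1 <= i <= n)%N -> u != a i) ->
  exists2 i, (i <= n)%N & a i < u < a i.+1.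
Proof.
move=> Hf /andP[u0 u1] ua.
suff H j : (j <= n.+1)%N -> u < a j -> exists2 i, (i <= n)%N & a i < u < a i.+1.
  by apply: (H n.+1) => //; rewrite (jump_last Hf).
elim: j => [_|j IH jn uj]; first by rewrite (jump_first Hf) ltNge ltW.
case: (ltgtP u (a j)) => [||uE]; first exact/IH/ltnW.
  by move=> ju; exists j => //; rewrite ju.
case: j => [|j] in uE jn IH uj *; first by move: u0; rewrite uE (jump_first Hf) ltxx.
by move: (ua j.+1); rewrite uE eqxx; move=> /(_ jn).
Qed.

Lemma jump_partition_continuous (R : realType) (f : R -> R) n (a : nat -> R) u :
  jump_partition f n a -> 0 < u < 1 ->
  (forall i, (1 <= i <= n)%N -> u != a i) -> {for u, continuous f}.
Proof.
move=> Hf u01 ua; have [i iN aiu] := jump_partition_interval Hf u01 ua.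
by apply: (jump_continuous Hf iN); rewrite in_itv.
Qed.

Lemma jump_partition_measurable (R : realType) (f : R -> R) n (a : nat -> R) :
  jump_partition f n a -> measurable_fun `[0 : R, 1] f.
Proof.
move=> Hf.
suff H j : (j <= n.+1)%N -> 0 <= a j /\ measurable_fun `[0, a j] f.
  by have [_] := H n.+1 (leqnn _); rewrite (jump_last Hf).
elim: j => [_|j IH jn].
  by rewrite (jump_first Hf) set_itv1; split => //; exact: measurable_fun_set1.
have [aj0 mf] := IH (ltnW jn); have ajS := jump_lt Hf jn.
split; first by rewrite (le_trans aj0)// ltW.
rewrite (@itv_bndbnd_setU _ _ _ (BRight (a j))) ?bnd_simp// 1?ltW//.
apply/measurable_funU => //; split => //.
apply/measurable_fun_itv_bndo_bndcP.
apply: open_continuous_measurable_fun => //.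
by move=> x; rewrite inE; exact: (jump_continuous Hf).
Qed.

Lemma jump_partition_bounded_integrable (R : realType) (f : R -> R) n (a : nat -> R) :
  jump_partition f n a -> [bounded f x | x in `[0 : R, 1]] ->
  (@lebesgue_measure R).-integrable `[0, 1] (EFin \o f).
Proof.
move=> Hf bf; apply: measurable_bounded_integrable => //.
  by apply: compact_finite_measure; exact: segment_compact.
exact: jump_partition_measurable Hf.
Qed.

Lemma integrable_cstB (R : realType) (f : R -> R) (c A B : R) :
  (@lebesgue_measure R).-integrable `[A, B] (EFin \o f) ->
  (@lebesgue_measure R).-integrable `[A, B] (EFin \o (fun x => c - f x)).
Proof.
move=> intf.
rewrite (_ : _ \o _ = ((EFin \o cst c) \- (EFin \o f))%E)//.
apply: integrableB => //.
apply: continuous_compact_integrable; first exact: segment_compact.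
by move=> ?; exact: cvg_cst.
Qed.

(** * Topological preliminaries *)

Lemma continuous_comp_within (R : realType) (A : set R) (f U : R -> R) :
  {within A, continuous f} -> continuous U -> (forall z, A (U z)) ->
  continuous (f \o U).
Proof.
move=> /subspace_continuousP cf cU AU z.
apply: (@cvg_comp _ _ _ U f _ (within A (nbhs (U z)))); last exact: cf.
move=> B nB; have H : \forall y \near z, A (U y) -> B (U y) := cU z _ nB.
by apply: (@filterS _ (nbhs z) _ _ _ _ H) => y; apply; exact: AU.
Qed.

Lemma not_boundary (R : realType) (A : set R) (z : R) :
  (\forall y \near z, ~ A y) \/ (\forall y \near z, A y) -> ~ boundary A z.
Proof.
move=> [nA|zA] [cA iA]; last exact: iA.
by have [y [Ay /(_ Ay)]] := cA _ nA.
Qed.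

Lemma near_forall_leq (T : Type) (F : set_system T) (FF : Filter F)
    (P : nat -> T -> Prop) (n : nat) :
  (forall i, (i <= n)%N -> \forall x \near F, P i x) ->
  \forall x \near F, forall i, (i <= n)%N -> P i x.
Proof.
elim: n => [|n IH] HP.
  by near=> x => i; rewrite leqn0 => /eqP ->; near: x; exact: HP.
have HPn : \forall x \near F, forall i, (i <= n)%N -> P i x.
  by apply: IH => i /leqW; exact: HP.
near=> x => i; rewrite leq_eqVlt ltnS => /predU1P[->|].
  by near: x; exact: HP.
by move: i; near: x.
Unshelve. all: by end_near. Qed.

(** * Flux and strict monotonicity of a decreasing solution *)

Section DecreasingProfile.
Variables (R : realType) (p s c : R) (g d h : R -> R) (r : nat) (m : nat -> R).
Variables (q : nat) (k : nat -> R) (U : R -> R).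
Hypotheses (Hg : g_assumptions s g) (Hd : d_assumptions p g d r m)
  (Hh : h_assumptions s h q k) (HU : decreasing_solution p g d h r m c U).

Let v := flux p d r m U.
Let cU : continuous U := sol_continuous (dec_solution HU).
Let U01 z : 0 <= U z <= 1 := sol_range (dec_solution HU) z.
Let U_nincr z z' : z <= z' -> U z' <= U z.
Proof. by move=> zz'; exact: (dec_nonincreasing HU). Qed.

Lemma near_profile_neq (z u : R) : U z != u -> \forall y \near z, U y != u.
Proof.
rewrite neq_lt => /orP[Uz|Uz]; near=> y.
  by rewrite lt_eqF//; near: y; exact: (@cvgr_lt _ _ _ _ U _ (@cU z) _ Uz).
by rewrite gt_eqF//; near: y; exact: (@cvgr_gt _ _ _ _ U _ (@cU z) _ Uz).
Unshelve. all: by end_near. Qed.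

Lemma not_boundary_N (z : R) : 0 < U z < 1 -> ~ boundary (N_set U) z.
Proof.
move=> /andP[U0 U1]; apply: not_boundary; left.
have Uz0 : U z != 0 by rewrite gt_eqF.
have Uz1 : U z != 1 by rewrite lt_eqF.
near=> y => -[] Uy.
  have : U y != 0 by near: y; exact: near_profile_neq.
  by rewrite Uy eqxx.
have : U y != 1 by near: y; exact: near_profile_neq.
by rewrite Uy eqxx.
Unshelve. all: by end_near. Qed.

Lemma not_boundary_M (z : R) :
  (forall i, (1 <= i <= r)%N -> U z != m i) -> ~ boundary (M_set r m U) z.
Proof.
move=> Uz; apply: not_boundary; left.
have : \forall y \near z, forall i, (i <= r)%N -> (1 <= i)%N -> U y != m i.
  apply: (@near_forall_leq _ (nbhs z) _
    (fun i y => (1 <= i)%N -> U y != m i)) => i ir.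
  case: (leqP 1 i) => i1; last exact: nearW.
  by near=> y => _; near: y; apply: near_profile_neq; rewrite Uz// i1.
apply: filterS => y Hy [i /andP[i1 ir] Uy].
by have := Hy i ir i1; rewrite /= Uy eqxx.
Unshelve. all: by end_near. Qed.

Lemma not_boundary_const (A : set R) (z : R) :
  (\forall y \near z, U y = U z) -> ~ boundary [set x | A (U x)] z.
Proof.
move=> Uc; apply: not_boundary.
case: (pselect (A (U z))) => AUz; [right|left]; near=> y.
  by rewrite /= (_ : U y = U z)//; near: y.
by rewrite /= (_ : U y = U z)//; near: y.
Unshelve. all: by end_near. Qed.

(** All level sets of a locally constant profile are locally empty or full, so
    the point lies on no boundary and the flux is given by the zero
    derivative. *)
Lemma flux_locally_constant (z : R) : (\forall y \near z, U y = U z) -> v z = 0.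
Proof.
move=> Uc; have H : \forall y \near z, U y = cst (U z) y by exact: Uc.
rewrite /v /flux memNset; last first.
  exact: (@not_boundary_const (fun u => exists2 i, (1 <= i <= r)%N & u = m i)).
rewrite memNset; last exact: (@not_boundary_const (fun u => u = 0 \/ u = 1)).
rewrite derive1E (@near_eq_derive R R R U (cst (U z)) z 1 H) derive_cst.
by rewrite /plap !mulr0.
Qed.

Lemma fluxE (z : R) : 0 < U z < 1 -> ~ boundary (M_set r m U) z ->
  v z = d (U z) * plap p (derive1 U z).
Proof.
move=> Uz nM; rewrite /v /flux.
have nN := not_boundary_N Uz.
by rewrite !memNset.
Qed.

Lemma diff_quot_le0 (z e : R) : diff_quot U z e <= 0.
Proof.
rewrite /diff_quot; case: (leP e 0) => [e0|/ltW e0].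
  by rewrite mulr_le0_ge0// ?invr_le0// subr_ge0 U_nincr// gerDr.
by rewrite mulr_ge0_le0// ?invr_ge0// subr_le0 U_nincr// lerDr.
Qed.

Lemma derive1_profile_lt0 (z : R) : 0 < U z < 1 ->
  ~ boundary (M_set r m U) z -> derivable U z 1 /\ derive1 U z < 0.
Proof.
move=> Uz nM; have nD : ~ D_set r m U z.
  by move=> [//|]; exact: not_boundary_N.
have [dU _] := sol_C1 (dec_solution HU) nD.
split => //; rewrite lt_neqAle (sol_deriv_neq0 (dec_solution HU))//=.
rewrite derive1E; apply: limr_le; first exact: dU.
by apply: nearW => e; rewrite scaler1; exact: diff_quot_le0.
Qed.

(** The left limit of [d \o U] at a transition point is positive because
    lower semicontinuity bounds it from below by [d (U z) / 2]. *)
Lemma fluxl_lt0 (z : R) : 0 < U z < 1 -> boundary (M_set r m U) z ->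
  fluxl p d U z < 0.
Proof.
move=> Uz Mz; rewrite /fluxl pmulr_llt0.
  apply: plap_lt0; have [cl nz] := sol_derivl (dec_solution HU) Mz.
  rewrite lt_neqAle nz /=; apply: limr_le => //.
  by apply: nearW => e; exact: diff_quot_le0.
have dz : 0 < d (U z) by exact: (d_gt0 Hd).
have [dl _] := sol_dlim (dec_solution HU) Mz.
apply: (@lt_le_trans _ _ (d (U z) / 2)); first by rewrite divr_gt0.
apply: limr_ge => //.
have : ((d (U z) / 2)%:E < (d (U z))%:E)%E by rewrite lte_fin; lra.
move=> /(d_lsc Hd)[V nV HV].
have : within `[0, 1]%classic (nbhs (U z)) V.
  by rewrite nbhs_subspace_in; [exact: nV|rewrite /= in_itv/= U01].
move=> /(@cU z) UV; apply: cvg_within.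
apply: (@filterS _ (nbhs z) _ _ _ _ UV) => y /= Vy.
by apply/ltW; rewrite -lte_fin; apply/HV/Vy; rewrite /= in_itv/=.
Qed.

Lemma flux_lt0 (z : R) : 0 < U z < 1 -> v z < 0.
Proof.
move=> Uz; case: (pselect (boundary (M_set r m U) z)) => Mz.
  by rewrite /v /flux mem_set//; exact: fluxl_lt0.
rewrite fluxE// pmulr_rlt0; last exact: (d_gt0 Hd).
by apply: plap_lt0; have [] := derive1_profile_lt0 Uz Mz.
Qed.

(** A level interval inside the range (0, 1) would carry zero flux, whereas the
    flux is negative there. *)
Lemma profile_decreasing (z z' : R) : 0 < U z < 1 -> z < z' -> U z' < U z.
Proof.
move=> Uz zz'; rewrite lt_neqAle U_nincr ?(ltW zz')// andbT; apply/eqP => UE.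
have const y : z <= y <= z' -> U y = U z.
  by move=> /andP[zy yz']; apply/le_anti; rewrite U_nincr//= -UE U_nincr.
pose x := (z + z') / 2.
have xz : z < x < z' by rewrite /x; apply/andP; split; lra.
have Ux : U x = U z by case/andP: xz => *; apply: const; rewrite !ltW.
have near_const : \forall y \near x, U y = U x.
  near=> y; rewrite Ux; apply: const; apply/andP; split; near: y.
    by apply: lt_le_nbhsr; case/andP: xz.
  by apply: lt_le_nbhsl; case/andP: xz.
have : v x < 0 by apply: flux_lt0; rewrite Ux.
by rewrite flux_locally_constant// ltxx.
Unshelve. all: by end_near. Qed.

Lemma near_right_profile_neq (z u : R) : 0 < U z < 1 -> \forall y \near z^'+, U y != u.
Proof.
move=> Uz; case: (eqVneq (U z) u) => [<-|nu].
  by near=> y; rewrite lt_eqF// profile_decreasing.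
by apply: cvg_within; exact: near_profile_neq.
Unshelve. all: by end_near. Qed.

Lemma near_left_profile_neq (z u : R) : 0 < U z < 1 -> \forall y \near z^'-, U y != u.
Proof.
move=> Uz; case: (eqVneq (U z) u) => [<-|nu]; last first.
  by apply: cvg_within; exact: near_profile_neq.
near=> y; apply/eqP => Uy.
have : U z < U y by apply: profile_decreasing => //; rewrite Uy.
by rewrite Uy ltxx.
Unshelve. all: by end_near. Qed.

(** If [U] reaches 1 at [z] it stays equal to 1 on the left of [z], where the
    flux therefore vanishes; continuity of the flux carries this to [z]. *)
Lemma flux_at1 (z : R) : U z = 1 -> v z = 0.
Proof.
move=> Uz; have v0 y : y < z -> v y = 0.
  move=> yz; apply: flux_locally_constant.
  have U1 x : x < z -> U x = 1.
    move=> xz; apply/le_anti; case/andP: (U01 x) => _ -> /=.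
    by rewrite -Uz U_nincr// ltW.
  near=> x; rewrite !U1//; near: x; exact: lt_nbhsl.
have vz : v x @[x --> z^'-] --> v z.
  by apply: cvg_at_left_filter; exact: (sol_flux_continuous (dec_solution HU)).
apply/le_anti/andP; split.
  by apply: (cvgr_to_le vz); near=> y; rewrite v0.
by apply: (cvgr_to_ge vz); near=> y; rewrite v0.
Unshelve. all: by end_near. Qed.

Lemma flux_at0 (z : R) : U z = 0 -> v z = 0.
Proof.
move=> Uz; have v0 y : z < y -> v y = 0.
  move=> zy; apply: flux_locally_constant.
  have U0 x : z < x -> U x = 0.
    move=> zx; apply/le_anti; case/andP: (U01 x) => -> _; rewrite andbT.
    by rewrite -Uz U_nincr// ltW.
  near=> x; rewrite !U0//; near: x; exact: lt_nbhsr.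
have vz : v x @[x --> z^'+] --> v z.
  by apply: cvg_at_right_filter; exact: (sol_flux_continuous (dec_solution HU)).
apply/le_anti/andP; split.
  by apply: (cvgr_to_le vz); near=> y; rewrite v0.
by apply: (cvgr_to_ge vz); near=> y; rewrite v0.
Unshelve. all: by end_near. Qed.

Let inth : (@lebesgue_measure R).-integrable `[0, 1] (EFin \o h) :=
  jump_partition_bounded_integrable (h_jumps Hh) (h_bounded Hh).

Let cg : continuous (g \o U).
Proof.
apply: continuous_comp_within (g_continuous Hg) cU _ => z.
by rewrite /= in_itv/= U01.
Qed.

(** The levels at which [d] and [h] are continuous and [U] is of class C1. *)
Let regular (u : R) := [/\ 0 < u < 1,
  forall i, (1 <= i <= r)%N -> u != m i &
  forall j, (1 <= j <= q)%N -> u != k j].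

(** Differentiation of the integrated equation: at a regular level [h] is
    continuous, so its primitive is differentiable there, and [U] is
    differentiable because the point lies on neither boundary. *)
Lemma is_derive_flux (y : R) : regular (U y) ->
  is_derive y 1 v ((h (U y) - c) * derive1 U y - g (U y)).
Proof.
move=> [Uy Um Uk].
have [dU _] := derive1_profile_lt0 Uy (not_boundary_M Um).
have dU1 : is_derive y 1 U (derive1 U y) by apply: DeriveDef => //; rewrite derive1E.
have dH : is_derive y 1 (oint h 0 \o U) (h (U y) * derive1 U y).
  apply: is_derive1_comp => //.
  by apply: (is_derive_oint inth); rewrite ?lexx ?ler01//;
    exact: (jump_partition_continuous (h_jumps Hh)).
have dG : is_derive y 1 (oint (g \o U) y) (g (U y)).
  have intg : (@lebesgue_measure R).-integrable `[y - 1, y + 1] (EFin \o (g \o U)).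
    apply: continuous_compact_integrable; first exact: segment_compact.
    exact: continuous_subspaceT.
  apply: (is_derive_oint intg); last exact: cg.
    by apply/andP; split; lra.
  by apply/andP; split; lra.
have dcU := is_deriveZ c dU1.
have dcst := is_derive_cst (v y + c * U y - oint h 0 (U y)) y (1 : R).
have := is_deriveD dcst (is_deriveB (is_deriveB dH dcU) dG).
rewrite add0r -scalerBl.
suff <- : v = cst (v y + c * U y - oint h 0 (U y)) +
    (oint h 0 \o U - c *: U - oint (g \o U) y).
  by [].
apply/funext => z; have := sol_equation (dec_solution HU) y z.
by rewrite /= -!/v !fctE /= -[c *: U z]/(c * U z); lra.
Qed.

(** * The barrier *)

Hypotheses (p1 : 1 < p) (s01 : 0 < s < 1).

Let Phi : R -> R := oint (fun x => h s - h x) s.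
(** [F] measures how far minus the flux lies above the barrier [Phi / p]. *)
Let F (z : R) : R := - v z - Phi (U z) / p.

Let intPhi : (@lebesgue_measure R).-integrable `[0, 1]
  (EFin \o (fun x => h s - h x)) := integrable_cstB (h s) inth.

Let s_in : 0 <= s <= 1.
Proof. by case/andP: s01 => *; rewrite !ltW. Qed.

Let cPhi : {within `[0, 1], continuous Phi} := continuous_oint intPhi s_in.

Let Phi_s : Phi s = 0.
Proof. by rewrite /Phi /oint lexx set_itv1 Rintegral_set1. Qed.

Lemma continuous_comparison : continuous F.
Proof.
have cPU : continuous (Phi \o U).
  apply: continuous_comp_within cPhi cU _ => z.
  by rewrite /= in_itv/= U01.
move=> z; apply: cvgB; last by apply: cvgMl; exact: cPU.
by apply: cvgN; exact: (sol_flux_continuous (dec_solution HU)).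
Qed.

Lemma is_derive_comparison (y : R) : regular (U y) ->
  is_derive y 1 F (derive1 U y * (c - h (U y) - (h s - h (U y)) / p) + g (U y)).
Proof.
move=> Uyr; have dv := is_derive_flux Uyr.
have [Uy Um Uk] := Uyr.
have [dU _] := derive1_profile_lt0 Uy (not_boundary_M Um).
have dU1 : is_derive y 1 U (derive1 U y) by apply: DeriveDef => //; rewrite derive1E.
have dP : is_derive y 1 (Phi \o U) ((h s - h (U y)) * derive1 U y).
  apply: is_derive1_comp => //.
  apply: (is_derive_oint intPhi) => //.
  apply: cvgB; first exact: cvg_cst.
  exact: (jump_partition_continuous (h_jumps Hh)).
have := is_deriveB (is_deriveN dv) (is_deriveZ p^-1 dP).
have -> : - v - p^-1 *: (Phi \o U) = F.
  by apply/funext => z; rewrite /F !fctE /= [RHS]/= mulrC.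
move=> dF; apply: is_derive_eq.
by rewrite -[_ *: _]/(p^-1 * _); ring.
Qed.

Lemma flux_powR (y : R) : 0 < U y < 1 -> ~ boundary (M_set r m U) y ->
  - v y = d (U y) * (- derive1 U y) `^ (p - 1).
Proof.
move=> Uy nM; have [_ dU] := derive1_profile_lt0 Uy nM.
rewrite fluxE// /plap ltr0_norm//.
have := @mulr_powRB1 _ (- derive1 U y) (p - 1).
rewrite oppr_ge0 subr_gt0 => /(_ (ltW dU) p1) <-.
have -> : p - 1 - 1 = p - 2 by ring.
by ring.
Qed.

(** Above the barrier [slope_bound] beats the reaction term; the remaining
    contribution [U' * (c - h s)] has the right sign as [h s <= c]. *)
Lemma comparison_slope_right (y : R) : h s <= c ->
  d (U y) `^ (p - 1)^-1 * g (U y) <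
    (p / (p - 1) * p `^ (p - 1)^-1)^-1 * (h s - h (U y)) * Phi (U y) `^ (p - 1)^-1 ->
  0 < Phi (U y) -> s < U y -> regular (U y) -> 0 < F y ->
  exists2 l, is_derive y 1 F l & l < 0.
Proof.
move=> hsc Hr P0 sU Uyr F0; apply: (ex_intro2 _ _ _ (is_derive_comparison Uyr)).
have [Uy Um _] := Uyr; have nM := not_boundary_M Um.
have [_ dU] := derive1_profile_lt0 Uy nM.
have n0 : 0 < - derive1 U y by rewrite oppr_gt0.
have PD : Phi (U y) / p < d (U y) * (- derive1 U y) `^ (p - 1).
  by rewrite -flux_powR// -subr_gt0.
have g0 : 0 < g (U y) by apply: (g_gt0 Hg); rewrite sU; case/andP: Uy.
have := slope_bound p1 (d_gt0 Hd Uy) P0 n0 g0 PD Hr.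
have : 0 <= - derive1 U y * (c - h s) by rewrite mulr_ge0 ?subr_ge0 ?(ltW n0).
by lra.
Qed.

Lemma comparison_slope_left (y : R) : c <= h s ->
  d (U y) `^ (p - 1)^-1 * g (U y) >
    (p / (p - 1) * p `^ (p - 1)^-1)^-1 * (h s - h (U y)) * Phi (U y) `^ (p - 1)^-1 ->
  0 < Phi (U y) -> U y < s -> regular (U y) -> 0 < F y ->
  exists2 l, is_derive y 1 F l & 0 < l.
Proof.
move=> chs Hl P0 Us Uyr F0; apply: (ex_intro2 _ _ _ (is_derive_comparison Uyr)).
have [Uy Um _] := Uyr; have nM := not_boundary_M Um.
have [_ dU] := derive1_profile_lt0 Uy nM.
have n0 : 0 < - derive1 U y by rewrite oppr_gt0.
have PD : Phi (U y) / p < d (U y) * (- derive1 U y) `^ (p - 1).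
  by rewrite -flux_powR// -subr_gt0.
have g0 : 0 < - g (U y).
  by rewrite oppr_gt0; apply: (g_lt0 Hg); rewrite Us andbT; case/andP: Uy.
have Hl' : d (U y) `^ (p - 1)^-1 * - g (U y) <
    (p / (p - 1) * p `^ (p - 1)^-1)^-1 * (h (U y) - h s) * Phi (U y) `^ (p - 1)^-1.
  by rewrite mulrN -[h (U y) - h s]opprB mulrN mulNr ltrN2.
(* Below [s] both the reaction and [h s - h] change sign: the estimate is used
   with [a := h (U y) - h s] and [G := - g (U y)]. *)
have := slope_bound p1 (d_gt0 Hd Uy) P0 n0 g0 PD Hl'.
have : 0 <= - derive1 U y * (h s - c) by rewrite mulr_ge0 ?subr_ge0 ?(ltW n0).
by lra.
Qed.

(** Only finitely many levels are irregular, so it suffices to avoid each of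
    them separately. *)
Lemma near_regular (G : set_system R) {FG : Filter G} (z : R) : G --> z ->
  0 < U z < 1 -> (forall u, \forall y \near G, U y != u) ->
  \forall y \near G, regular (U y).
Proof.
move=> Gz /andP[Uz0 Uz1] avoid.
have Um : \forall y \near G, forall i, (i <= r)%N -> U y != m i.
  by apply: (@near_forall_leq _ G _ (fun i y => U y != m i)) => i _.
have Uk : \forall y \near G, forall j, (j <= q)%N -> U y != k j.
  by apply: (@near_forall_leq _ G _ (fun j y => U y != k j)) => j _.
have U0 : \forall y \near G, 0 < U y.
  by apply: Gz; exact: (@cvgr_gt _ _ _ _ U _ (@cU z) _ Uz0).
have U1 : \forall y \near G, U y < 1.
  by apply: Gz; exact: (@cvgr_lt _ _ _ _ U _ (@cU z) _ Uz1).
near=> y; split.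
- by apply/andP; split; near: y.
- by move=> i /andP[_]; move: i; near: y.
- by move=> j /andP[_]; move: j; near: y.
Unshelve. all: by end_near. Qed.

Hypothesis Phi_gt0 : forall t, 0 <= t <= 1 -> t != s -> 0 < Phi t.

(** At either end of the line the flux tends to 0 while the barrier tends to a
    positive value. *)
Lemma comparison_limit (G : set_system R) (FG : ProperFilter G) (t : R) :
  0 <= t <= 1 -> t != s -> U z @[z --> G] --> t -> v z @[z --> G] --> (0 : R) ->
  \forall z \near G, F z < 0.
Proof.
move=> t01 ts Ut v0.
have At : `[0, 1]%classic t by rewrite /= in_itv.
have PU : Phi (U z) @[z --> G] --> Phi t.
  apply: (@cvg_comp _ _ _ U Phi _ (within `[0, 1]%classic (nbhs t))).
    move=> B nB.
    have H : \forall z \near G, `[0, 1]%classic (U z) -> B (U z) := Ut _ nB.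
    by apply: (@filterS _ G _ _ _ _ H) => z; apply; rewrite /= in_itv/= U01.
  by move/subspace_continuousP: cPhi; exact.
have FU : F z @[z --> G] --> - 0 - Phi t / p.
  by apply: cvgB; [exact: cvgN|exact: cvgMl].
have Ft : - 0 - Phi t / p < 0.
  by rewrite oppr0 sub0r oppr_lt0 divr_gt0 ?Phi_gt0// (lt_trans ltr01).
exact: (@cvgr_lt _ _ _ _ F _ FU _ Ft).
Qed.

Lemma exists_profile_level : exists z, U z = s.
Proof.
case/andP: s01 => s0 s1.
have [a Ua] : exists a, s < U a.
  near (ninfty_nbhs R) => a; exists a; near: a.
  exact: (@cvgr_gt _ _ _ _ U _ (dec_ninfty HU) _ s1).
have [b ba Ub] : exists2 b, a <= b & U b < s.
  near (pinfty_nbhs R) => b; exists b; near: b.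
    by apply: nbhs_pinfty_ge; exact: num_real.
  exact: (@cvgr_lt _ _ _ _ U _ (dec_pinfty HU) _ s0).
have [|x _ Ux] := @IVT _ U a b s ba (continuous_subspaceT cU).
  by rewrite ge_min le_max !(ltW Ua) !(ltW Ub) orbT.
by exists x.
Unshelve. all: by end_near. Qed.

Lemma comparison_at_level (z : R) : U z = s -> 0 < F z.
Proof.
by move=> Uz; rewrite /F Uz Phi_s mul0r subr0 oppr_gt0 flux_lt0// Uz.
Qed.

(** The flux vanishes at the levels 0 and 1 and the barrier at the level [s], so
    a zero of [F] can only occur at an interior level different from [s]. *)
Lemma comparison_zero (z : R) : F z = 0 -> 0 < U z < 1 /\ U z != s.
Proof.
move=> Fz; have p0 : 0 < p by exact: lt_trans p1.
have end_lt0 t : v z = 0 -> U z = t -> 0 <= t <= 1 -> t != s -> False.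
  move=> vz Uz t01 ts; have := Phi_gt0 t01 ts.
  have := Fz; rewrite /F vz Uz oppr0 sub0r => /eqP.
  by rewrite oppr_eq0 mulf_eq0 invr_eq0 (gt_eqF p0) orbF => /eqP ->; rewrite ltxx.
case/andP: s01 => s0 s1.
have Us : U z != s.
  by apply/eqP => /comparison_at_level; rewrite Fz ltxx.
split => //; have /andP[U0 U1] := U01 z.
apply/andP; split; rewrite lt_neqAle ?U0 ?U1 andbT; apply/eqP => Uz.
  by apply: (end_lt0 0); rewrite ?lexx ?ler01 ?lt_eqF// flux_at0.
by apply: (end_lt0 1); rewrite ?lexx ?ler01 ?gt_eqF// flux_at1.
Qed.

(** [F] is negative near -oo and positive where [U] equals [s], so it crosses 0
    upwards at a level above [s]; the slope estimate there forbids it. *)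
Lemma no_profile_speed_ge : h s <= c ->
  (forall t, s < t < 1 -> d t `^ (p - 1)^-1 * g t <
    (p / (p - 1) * p `^ (p - 1)^-1)^-1 * (h s - h t) * Phi t `^ (p - 1)^-1) ->
  False.
Proof.
move=> hsc Hright; have [b Ub] := exists_profile_level.
have /andP[s0 s1] := s01.
have Fny : \forall z \near -oo, F z < 0.
  apply: (@comparison_limit _ _ 1); rewrite ?lexx ?ler01 ?gt_eqF//.
    exact: (dec_ninfty HU).
  exact: (sol_flux_ninfty (dec_solution HU)).
have [a ab Fa] : exists2 a, a < b & F a < 0.
  near (ninfty_nbhs R) => a; exists a; near: a => //.
  by apply: nbhs_ninfty_lt; exact: num_real.
apply: (no_upcrossing_of_slope_lt0 continuous_comparison ab Fa (comparison_at_level Ub)).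
move=> x xb Fx; have [Ux Uxs] := comparison_zero Fx.
have sUx : s < U x by rewrite lt_neqAle eq_sym Uxs -Ub U_nincr// ltW.
have sU : \forall y \near x^'+, s < U y.
  by apply: cvg_within; exact: (@cvgr_gt _ _ _ _ U _ (@cU x) _ sUx).
have Ur : \forall y \near x^'+, regular (U y).
  apply: (near_regular (z := x) _ Ux); first exact: cvg_within.
  by move=> u; exact: near_right_profile_neq.
near=> y => Fy; have sUy : s < U y by near: y.
have Uyr : regular (U y) by near: y.
have [/andP[Uy0 Uy1] _ _] := Uyr.
apply: comparison_slope_right => //; first by apply: Hright; rewrite sUy.
by apply: Phi_gt0; rewrite ?gt_eqF// !ltW.
Unshelve. all: by end_near. Qed.

Lemma no_profile_speed_le : c <= h s ->
  (forall t, 0 < t < s -> d t `^ (p - 1)^-1 * g t >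
    (p / (p - 1) * p `^ (p - 1)^-1)^-1 * (h s - h t) * Phi t `^ (p - 1)^-1) ->
  False.
Proof.
move=> chs Hleft; have [a Ua] := exists_profile_level.
have /andP[s0 s1] := s01.
have Fy : \forall z \near +oo, F z < 0.
  apply: (@comparison_limit _ _ 0); rewrite ?lexx ?ler01 ?lt_eqF//.
    exact: (dec_pinfty HU).
  exact: (sol_flux_pinfty (dec_solution HU)).
have [b ab Fb] : exists2 b, a < b & F b < 0.
  near (pinfty_nbhs R) => b; exists b; near: b => //.
  by apply: nbhs_pinfty_gt; exact: num_real.
apply: (no_downcrossing_of_slope_gt0 continuous_comparison ab (comparison_at_level Ua) Fb).
move=> x ax Fx; have [Ux Uxs] := comparison_zero Fx.
have Usx : U x < s by rewrite lt_neqAle Uxs -Ua U_nincr// ltW.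
have Us : \forall y \near x^'-, U y < s.
  by apply: cvg_within; exact: (@cvgr_lt _ _ _ _ U _ (@cU x) _ Usx).
have Ur : \forall y \near x^'-, regular (U y).
  apply: (near_regular (z := x) _ Ux); first exact: cvg_within.
  by move=> u; exact: near_left_profile_neq.
near=> y => Fy0; have Usy : U y < s by near: y.
have Uyr : regular (U y) by near: y.
have [/andP[Uy0 Uy1] _ _] := Uyr.
apply: comparison_slope_left => //; first by apply: Hleft; rewrite Uy0.
by apply: Phi_gt0; rewrite ?lt_eqF// !ltW.
Unshelve. all: by end_near. Qed.

End DecreasingProfile.

(** * Nonexistence *)

Unset Implicit Arguments.

Theorem theorem2p3 (R : realType) (p p' s : R) (g d h : R -> R)
  (r : nat) (m : nat -> R) (q : nat) (k : nat -> R)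
  (p_gt1 : 1 < p) (conj_pp' : p^-1 + p'^-1 = 1) (s01 : 0 < s < 1)
  (Hg : g_assumptions s g) (Hd : d_assumptions p g d r m)
  (Hh : h_assumptions s h q k)
  (Hpos : forall t, 0 <= t <= 1 -> t != s ->
    0 < oint (fun x => h s - h x) s t)
  (Hright : forall t, s < t < 1 ->
    d t `^ (p - 1)^-1 * g t <
    (p' * p `^ (p' / p))^-1 * (h s - h t)
      * oint (fun x => h s - h x) s t `^ (p' / p))
  (Hleft : forall t, 0 < t < s ->
    d t `^ (p - 1)^-1 * g t >
    (p' * p `^ (p' / p))^-1 * (h s - h t)
      * oint (fun x => h s - h x) s t `^ (p' / p)) :
  forall c : R, ~ exists U : R -> R, decreasing_solution p g d h r m c U.
Proof.
have p0 : 0 < p by exact: lt_trans p_gt1.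
have p'E : p' = p / (p - 1).
  rewrite -[p']invrK -[p'^-1](addKr p^-1) conj_pp'.
  by field; rewrite !gt_eqF ?subr_gt0.
have p'p : p' / p = (p - 1)^-1 by rewrite p'E; field; rewrite !gt_eqF ?subr_gt0.
move: Hright Hleft; rewrite p'p p'E => Hr Hl c [U HU].
have [hsc|/ltW chs] := leP (h s) c.
  exact: (no_profile_speed_ge Hg Hd Hh HU p_gt1 s01 Hpos hsc Hr).
exact: (no_profile_speed_le Hg Hd Hh HU p_gt1 s01 Hpos chs Hl).
Qed.
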